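(* Let $X$ be a $k$-semigraph algebra. If $X$ is free, then $X$ is weakly free.
   Context: SEMIGRAPHS. A semimultiplicative set is a set $T$ with a subset $T^{\{2\}}\subseteq T\times T$ and a multiplication $T^{\{2\}}\to T$, $(s,t)\mapsto st$, that is associative: for all $s,t,u\in T$, $(st)u$ is defined if and only if $s(tu)$ is defined, and both are equal if defined. Let $k$ be an index set (a natural number if finite). A $k$-semigraph is a semimultiplicative set $T$ with a degree map $d:T\to\mathbb{N}_0^k$ such that (1) $d(xy)=d(x)+d(y)$ whenever $xy$ is defined, and (2) whenever $d(x)=n_1+n_2$ with $n_1,n_2\in\mathbb{N}_0^k$ there are unique $x_1,x_2\in T$ with $x=x_1x_2$, $d(x_1)=n_1$, $d(x_2)=n_2$. $T^{(n)}$ is the set of elements of degree $n$; $e_i$ is the $i$th unit vector. With $\vee$ the coordinatewise maximum, $T^{(\min)}(x,y)=\{(\alpha,\beta)\in T\times T\mid x\alpha, y\beta \text{ defined},\ x\alpha=y\beta,\ d(x\alpha)=d(x)\vee d(y)\}$; $T$ is finitely aligned if all these sets are finite. $T$ is non-unital if $T=T_1\setminus\{1\}$ for a $k$-semigraph $T_1$ with unit $1$. ALGEBRAS. In a $*$-algebra (over $\mathbb{C}$, with involution), $s$ is a partial isometry if $ss^*s=s$, a projection is $p=p^2=p^*$; $P_a=aa^*$, $Q_a=a^*a$; for projections $p\le q$ means $pq=p$, and $p<q$ means $p\le q$, $p\ne q$; $\bigvee$ is the supremum of commuting projections ($p\vee q=p+q-pq$). SEMIGRAPH ALGEBRAS.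 Given disjoint $\mathcal{P},\mathcal{T}$ with $\mathcal{T}$ a non-unital $k$-semigraph, $\mathcal{T}_1=\mathcal{T}\sqcup\{1\}$; $\mathbb{F}$ is the free non-unital $*$-algebra on $\mathcal{P}\cup\mathcal{T}$. A word is a $*$-monomial in the letters $\mathcal{P}\cup\mathcal{T}$. The degree of a word in $\mathbb{F}$ is the sum of the degrees of its letters, where $t\in\mathcal{T}$ has its semigraph degree, $p\in\mathcal{P}$ has degree $0$ and $d(x^* )=-d(x)$. The fiber space of $\mathbb{F}$ is the union over $n\in\mathbb{Z}^k$ of the linear spans of the words of degree $n$. A $k$-semigraph algebra is a $*$-algebra $X$ generated by disjoint subsets $\mathcal{P},\mathcal{T}$ such that: (i) $\mathcal{P}$ is a set of commuting projections closed under multiplication; (ii) $\mathcal{T}$ is a set of nonzero partial isometries closed under nonzero products; (iii) $\mathcal{T}$ is a non-unital finitely aligned $k$-semigraph; (iv) for all $x\in\mathcal{T}$, $p\in\mathcal{P}$ there is $q\in\mathcal{P}$ with $px=xq$; (v) for all $x,y\in\mathcal{T}$ there are $q_{x,y,\alpha,\beta}\in\mathcal{P}$ with $x^*y=\sum_{(\alpha,\beta)\in\mathcal{T}_1^{(\min)}(x,y)}\alpha q_{x,y,\alpha,\beta}\beta^*$ (the unit $1$ of $\mathcal{T}_1$ acting as unit on $X$); (vi) $X$ is canonically isomorphic to the quotient of $\mathbb{F}$ by a subset of the fiber space. Half-standard words are the elements $sp$ with $s\in\mathcal{T}_1$, $p\in\mathcal{P}$. A standard projection is an element $P_x(1-P_{y_1})\cdots(1-P_{y_m})$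 of $X$ with $x,y_i$ half-standard words, $m\ge0$. All words form an inverse semigroup of partial isometries, so their range projections commute. $X^{\backslash i}$ is the $*$-subalgebra of $X$ generated by $\mathcal{P}$ and $\mathcal{T}^{\backslash i}=\{t\in\mathcal{T}\mid d(t)_i=0\}$; it is a semigraph algebra with these generators. $X$ is weakly free if for all $i\in k$, all nonzero standard projections $p$ of $X^{\backslash i}$ (formed with the generators of $X^{\backslash i}$) and all finite $\mathcal{B}\subseteq\mathcal{T}^{(e_i)}$ the inequality $p\le\sum_{b\in\mathcal{B}}P_b$ does not hold. $X$ is free if (i) $P_a\notin\mathcal{P}$ for every half-standard word $a\notin\mathcal{P}$, and (ii) if $p\in\mathcal{P}$ and $a_1,\ldots,a_n$ are half-standard words with $P_{a_i}<p$ for all $1\le i\le n$, then $\bigvee_{i=1}^nP_{a_i}<p$. *)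

(* Defs.v *)
From HB Require Import structures.
From mathcomp Require Import all_boot all_order all_algebra.
From mathcomp Require Import finmap monalg.
From mathcomp Require Import complex.
From mathcomp Require Import boolp classical_sets functions cardinality fsbigop.
From mathcomp Require Import reals.

Set Implicit Arguments.
Unset Strict Implicit.
Unset Printing Implicit Defensive.

Import Order.TTheory GRing.Theory Num.Theory.

Local Open Scope classical_set_scope.
Local Open Scope ring_scope.

(** * Semigraphs *)

(* A set [carrier] with a partially defined multiplication: [pmul s t] is
   meaningful only when [composable s t] holds. *)
Record partial_magma (S : Type) := PartialMagma {
  carrier : set S;
  composable : S -> S -> Prop;
  pmul : S -> S -> S }.

Record semimultiplicative (S : Type) (G : partial_magma S) : Prop := {
  pmul_closed : forall s t, carrier G s -> carrier G t ->
    composable G s t -> carrier G (pmul G s t);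
  pmul_assoc_def : forall s t u,
    carrier G s -> carrier G t -> carrier G u ->
    composable G s t /\ composable G (pmul G s t) u <->
    composable G t u /\ composable G s (pmul G t u);
  pmul_assoc : forall s t u,
    carrier G s -> carrier G t -> carrier G u ->
    composable G s t -> composable G (pmul G s t) u ->
    pmul G (pmul G s t) u = pmul G s (pmul G t u) }.

Record ksemigraph (k S : Type) (G : partial_magma S) (d : S -> k -> nat) :
    Prop := {
  ksemigraph_semimul : semimultiplicative G;
  ksemigraph_deg : forall x y, carrier G x -> carrier G y ->
    composable G x y -> forall i, d (pmul G x y) i = (d x i + d y i)%N;
  ksemigraph_fact : forall (x : S) (n1 n2 : k -> nat), carrier G x ->
    (forall i, d x i = (n1 i + n2 i)%N) ->
    exists! p : S * S,
      [/\ carrier G p.1 /\ carrier G p.2, composable G p.1 p.2,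
          x = pmul G p.1 p.2,
          (forall i, d p.1 i = n1 i) & (forall i, d p.2 i = n2 i)] }.

(* Degrees live in N_0^k, read as the set of all functions k -> nat. *)
Definition unit_deg (k : Type) (i : k) : k -> nat :=
  fun j => if `[< j = i >] then 1%N else 0%N.

Definition homogeneous (k S : Type) (A : set S) (d : S -> k -> nat)
    (n : k -> nat) : set S :=
  [set t | A t /\ forall i, d t i = n i].

Definition Tmin (k S : Type) (G : partial_magma S) (d : S -> k -> nat)
    (x y : S) : set (S * S) :=
  [set ab | [/\ carrier G ab.1 /\ carrier G ab.2,
                composable G x ab.1 /\ composable G y ab.2,
                pmul G x ab.1 = pmul G y ab.2 &
                forall i, d (pmul G x ab.1) i = maxn (d x i) (d y i)]].

Definition finitely_aligned (k S : Type) (G : partial_magma S)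
    (d : S -> k -> nat) : Prop :=
  forall x y, carrier G x -> carrier G y -> finite_set (Tmin G d x y).

(* T_1 = T |_| {1}, with [None] in the role of the unit 1. *)
Definition adjoin_unit (S : Type) (G : partial_magma S) :
    partial_magma (option S) :=
  PartialMagma
    [set a | if a is Some s then carrier G s else True]
    (fun a b => match a, b with
                | Some s, Some t => composable G s t
                | _, _ => True
                end)
    (fun a b => match a, b with
                | Some s, Some t => Some (pmul G s t)
                | None, _ => b
                | _, None => a
                end).

Definition deg1 (k S : Type) (d : S -> k -> nat) : option S -> k -> nat :=
  fun a i => if a is Some s then d s i else 0%N.

(* A non-unital k-semigraph is not itself a k-semigraph (the factorisations of
   x of degrees d(x) + 0 and 0 + d(x) involve 1); only T_1 is. *)
Definition nonunital_ksemigraph (k S : Type) (G : partial_magma S)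
    (d : S -> k -> nat) : Prop :=
  ksemigraph (adjoin_unit G) (deg1 d).

(** * Star-algebras, not necessarily unital *)

HB.mixin Record Lmodule_isStarAlgebra (C : numClosedFieldType) X
    of GRing.Lmodule C X := {
  smul : X -> X -> X;
  star : X -> X;
  smulA : associative smul;
  smulDl : left_distributive smul +%R;
  smulDr : right_distributive smul +%R;
  smulZl : forall (c : C) (a b : X), smul (c *: a) b = c *: smul a b;
  smulZr : forall (c : C) (a b : X), smul a (c *: b) = c *: smul a b;
  starK : involutive star;
  starD : {morph star : a b / a + b};
  starZ : forall (c : C) (a : X), star (c *: a) = c^* *: star a;
  starM : forall a b : X, star (smul a b) = smul (star b) (star a) }.

#[short(type="starAlgType")]
HB.structure Definition StarAlgebra (C : numClosedFieldType) :=
  { X of GRing.Lmodule C X & Lmodule_isStarAlgebra C X }.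

Notation "a ** b" := (smul a b) (at level 40, left associativity) : ring_scope.

Section StarAlgebraTheory.
Variables (C : numClosedFieldType) (X : starAlgType C).
Implicit Types (a b p q s : X) (A G : set X).

Definition partial_isometry s : Prop := s ** star s ** s = s.

Definition projection p : Prop := p = p ** p /\ p = star p.

Definition Pr a : X := a ** star a.

Definition proj_le p q : Prop := p ** q = p.
Definition proj_lt p q : Prop := proj_le p q /\ p <> q.

Definition proj_join p q : X := p + q - p ** q.
Definition proj_sup (ps : seq X) : X := foldr proj_join 0 ps.

Record star_subalgebra A : Prop := {
  star_subalgebra0 : A 0;
  star_subalgebraD : forall a b, A a -> A b -> A (a + b);
  star_subalgebraZ : forall (c : C) a, A a -> A (c *: a);
  star_subalgebraM : forall a b, A a -> A b -> A (a ** b);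
  star_subalgebra_star : forall a, A a -> A (star a) }.

Definition generates G : Prop :=
  forall A, star_subalgebra A -> G `<=` A -> A = setT.

(* Left and (starred) right action of T_1 on X, the unit 1 acting as the
   identity: [lact1 a x] is a x and [ract1_star x b] is x b^*. *)
Definition lact1 (a : option X) (x : X) : X :=
  if a is Some s then s ** x else x.
Definition ract1_star (x : X) (b : option X) : X :=
  if b is Some s then x ** star s else x.

End StarAlgebraTheory.

(** * The free non-unital star-algebra on a set of generators *)

(* The letter (g, false) is g, the letter (g, true) is the formal adjoint of
   g.  The free non-unital star-algebra is the span [free_nu] of the nonempty
   words inside the algebra of the free monoid on the letters. *)
Section FreeStarAlgebra.
Variables (C : numClosedFieldType) (X : starAlgType C) (G : set X).

Definition letter : choiceType := (set_type G * bool)%type.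
Definition word : choiceType := {fmonom letter}.
Definition word_alg := {malg C[{fmonom letter}]}.

Definition free_nu : set word_alg := [set f | f@_(@fmone letter) = 0].

Definition word_star (w : {fmonom letter}) : {fmonom letter} :=
  FMonom (rev [seq (l.1, ~~ l.2) | l <- (w : seq letter)]).

Definition free_star (f : word_alg) : word_alg :=
  \sum_(w <- msupp f) (f@_w)^* *: << word_star w >>.

Record star_ideal (J : set word_alg) : Prop := {
  star_ideal_sub : J `<=` free_nu;
  star_ideal0 : J 0;
  star_idealD : forall f g, J f -> J g -> J (f + g);
  star_idealZ : forall (c : C) f, J f -> J (c *: f);
  star_idealMl : forall f g, free_nu f -> J g -> J (f * g);
  star_idealMr : forall f g, J f -> free_nu g -> J (f * g);
  star_ideal_star : forall f, J f -> J (free_star f) }.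

Definition star_ideal_gen (S : set word_alg) : set word_alg :=
  [set f | forall J, star_ideal J -> S `<=` J -> J f].

Definition letter_val (l : letter) : X :=
  if l.2 then star (val l.1) else val l.1.

(* The value at the empty word is irrelevant. *)
Definition word_val (w : {fmonom letter}) : X :=
  if (w : seq letter) is l :: s then
    foldl (fun a m => a ** letter_val m) (letter_val l) s
  else 0.

(* On [free_nu] this is the canonical star-homomorphism to X. *)
Definition canonical_map (f : word_alg) : X :=
  \sum_(w <- msupp f) f@_w *: word_val w.

Variables (k : Type) (dg : X -> k -> nat).

Definition word_deg (w : {fmonom letter}) (i : k) : int :=
  \sum_(l <- (w : seq letter)) (-1) ^+ (l.2 : bool) * (dg (val l.1) i)%:Z.

Definition fiber_space : set word_alg :=
  [set f | exists (n : k -> int) (s : seq (C * {fmonom letter})),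
     (forall cw, cw \in s ->
        (cw.2 : seq letter) <> [::] /\ forall i, word_deg cw.2 i = n i) /\
     f = \sum_(cw <- s) cw.1 *: << cw.2 >>].

End FreeStarAlgebra.

(** * Semigraph algebras *)

Section SemigraphAlgebra.
Variables (C : numClosedFieldType) (X : starAlgType C) (k : Type).
Implicit Types (P T : set X) (d : X -> k -> nat).

(* T carries the multiplication of X, with s t defined iff s t <> 0 in X. *)
Definition gen_magma T : partial_magma X :=
  PartialMagma T (fun s t => s ** t <> 0) (fun s t => s ** t).

(* Only the values of d on T matter; letters from P have degree 0. *)
Definition gen_deg T d : X -> k -> nat :=
  fun x i => if x \in T then d x i else 0%N.

Record semigraph_algebra P T d : Prop := {
  sga_disjoint : P `&` T = set0;
  sga_generates : generates (P `|` T);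
  sga_P_proj : forall p, P p -> projection p;
  sga_P_comm : forall p q, P p -> P q -> p ** q = q ** p;
  sga_P_mul : forall p q, P p -> P q -> P (p ** q);
  sga_T_neq0 : forall t, T t -> t <> 0;
  sga_T_piso : forall t, T t -> partial_isometry t;
  sga_T_mul : forall s t, T s -> T t -> s ** t <> 0 -> T (s ** t);
  sga_T_semigraph : nonunital_ksemigraph (gen_magma T) d;
  sga_T_aligned : finitely_aligned (gen_magma T) d;
  sga_swap : forall x p, T x -> P p -> exists2 q, P q & p ** x = x ** q;
  (* The index set of the sum is finite by finite alignment of T and unique
     factorisation. *)
  sga_star_mul : forall x y, T x -> T y ->
    let M := Tmin (adjoin_unit (gen_magma T)) (deg1 d) (Some x) (Some y) in
    exists q : option X * option X -> X,
      (forall ab, M ab -> P (q ab)) /\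
      star x ** y =
        \sum_(ab \in M) lact1 ab.1 (ract1_star (q ab) ab.2);
  (* The canonical map, onto X by [sga_generates], has as kernel the
     star-ideal generated by a subset of the fiber space. *)
  sga_fiber : exists2 S : set (word_alg (P `|` T)),
    S `<=` fiber_space (gen_deg T d) &
    forall f, free_nu f -> (canonical_map f = 0 <-> star_ideal_gen S f) }.

Definition half_standard P T : set X :=
  [set a | exists s p, [/\ carrier (adjoin_unit (gen_magma T)) s, P p &
                           a = lact1 s p]].

(* x (1 - y), computed in X without a unit *)
Definition mul_compl (x y : X) : X := x - x ** y.

Definition standard_projection P T : set X :=
  [set e | exists (x : X) (ys : seq X),
     [/\ half_standard P T x, (forall y, y \in ys -> half_standard P T y) &
         e = foldl (fun z y => mul_compl z (Pr y)) (Pr x) ys]].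

Definition restr_gens T d (i : k) : set X := [set t | T t /\ d t i = 0%N].

Definition weakly_free P T d : Prop :=
  forall (i : k) (e : X), standard_projection P (restr_gens T d i) e ->
  e <> 0 ->
  forall B : {fset X}, [set` B] `<=` homogeneous T d (unit_deg i) ->
  ~ proj_le e (\sum_(b <- B) Pr b).

Definition free_semigraph_algebra P T : Prop :=
  (forall a, half_standard P T a -> ~ P a -> ~ P (Pr a)) /\
  (forall (p : X) (n : nat) (a : 'I_n.+1 -> X), P p ->
     (forall j, half_standard P T (a j)) ->
     (forall j, proj_lt (Pr (a j)) p) ->
     proj_lt (proj_sup [seq Pr (a j) | j <- enum 'I_n.+1]) p).

End SemigraphAlgebra.

(* Main.v *)
(* Let [x = s p] be a half-standard word and [p0 = x^* x], an element of P.
   Compressing by [x] turns the range projection of a word [y] into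
   [x^* P_y x], which is either an element of P (when [y = t q] and [t]
   left-divides [s]) or a sum of range projections [P_a] with [a = alpha u],
   [alpha] in T, [u] in P and [p0 a = a].  In the second case [P_a < p0]: by
   the first freeness condition [P_a = p0] forces [a] in P, hence [a = 0],
   because [alpha] has nonzero degree and the fiber relations keep words of
   different degrees apart.  If now [P_x (1 - P_y1) ... (1 - P_ym)] is nonzero
   and below a sum of [P_b], [b] in B, then all the [P_a] so obtained from the
   [y_j] and the [b] are strictly below [p0]; by the second freeness condition
   their supremum [S] is strictly below [p0], and [x (p0 - S)] is a nonzero
   element annihilated by all the [P_yj] and all the [P_b], which is absurd. *)
Require Import Defs.
From HB Require Import structures.
From mathcomp Require Import all_boot all_order all_algebra.
From mathcomp Require Import finmap monalg.
From mathcomp Require Import complex boolp classical_sets cardinality fsbigop.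
From mathcomp Require Import reals.

Set Implicit Arguments.
Unset Strict Implicit.
Unset Printing Implicit Defensive.

Import Order.TTheory GRing.Theory Num.Theory.

Local Open Scope classical_set_scope.
Local Open Scope ring_scope.

(** * Calculus in a star-algebra without unit; suprema of commuting projections *)

Section StarAlgebraLemmas.
Variables (C : numClosedFieldType) (X : starAlgType C).
Implicit Types (a b p q s x y : X) (ps : seq X).

Lemma smul0l x : 0 ** x = 0.
Proof. by have := smulZl 0 x x; rewrite !scale0r. Qed.

Lemma smul0r x : x ** 0 = 0.
Proof. by have := smulZr 0 x x; rewrite !scale0r. Qed.

Lemma smulNl x y : (- x) ** y = - (x ** y).
Proof. by rewrite -scaleN1r smulZl scaleN1r. Qed.

Lemma smulNr x y : x ** (- y) = - (x ** y).
Proof. by rewrite -scaleN1r smulZr scaleN1r. Qed.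

Lemma smulBl x y z : (x - y) ** z = x ** z - y ** z.
Proof. by rewrite smulDl smulNl. Qed.

Lemma smulBr x y z : z ** (x - y) = z ** x - z ** y.
Proof. by rewrite smulDr smulNr. Qed.

Lemma star0 : star (0 : X) = 0.
Proof. by have := starZ 0 (0 : X); rewrite conjC0 !scale0r. Qed.

Lemma smul_suml I (r : seq I) (Q : pred I) (F : I -> X) y :
  (\sum_(i <- r | Q i) F i) ** y = \sum_(i <- r | Q i) F i ** y.
Proof.
by apply: (big_morph (fun z => z ** y)) => [u v|]; rewrite ?smulDl ?smul0l.
Qed.

Lemma smul_sumr I (r : seq I) (Q : pred I) (F : I -> X) y :
  y ** (\sum_(i <- r | Q i) F i) = \sum_(i <- r | Q i) y ** F i.
Proof. by apply: (big_morph (smul y)) => [u v|]; rewrite ?smulDr ?smul0r. Qed.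

Lemma star_sum I (r : seq I) (Q : pred I) (F : I -> X) :
  star (\sum_(i <- r | Q i) F i) = \sum_(i <- r | Q i) star (F i).
Proof. by apply: big_morph => [u v|]; rewrite ?starD ?star0. Qed.

Lemma star_Pr a : star (Pr a) = Pr a.
Proof. by rewrite /Pr starM starK. Qed.

Lemma Pr_proj p : projection p -> Pr p = p.
Proof. by case=> pp ps; rewrite /Pr -ps -pp. Qed.

(* Over commuting projections [z (1 - p_1) ... (1 - p_n)] is [z - z S] with S
   the supremum; the identity itself holds for arbitrary elements. *)
Lemma foldl_mul_compl (f : X -> X) z ps :
  foldl (fun z y => mul_compl z (f y)) z ps
  = z - z ** proj_sup [seq f y | y <- ps].
Proof.
elim: ps z => [|y ps IH] z /=; first by rewrite smul0r subr0.
rewrite IH /mul_compl /proj_join !smulBr !smulDr smulBl !smulA.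
by rewrite !opprD !opprK !addrA.
Qed.

Lemma proj_sup_comm x ps :
  (forall p, p \in ps -> x ** p = p ** x) ->
  x ** proj_sup ps = proj_sup ps ** x.
Proof.
elim: ps => [|p ps IH] cx /=; first by rewrite smul0r smul0l.
have cp : x ** p = p ** x by apply: cx; rewrite mem_head.
have cs : x ** proj_sup ps = proj_sup ps ** x.
  by apply: IH => q qps; apply: cx; rewrite in_cons qps orbT.
by rewrite /proj_join smulBr smulBl smulDr smulDl smulA cp cs -!smulA cs.
Qed.

Lemma proj_sup_ub ps :
  (forall p, p \in ps -> p ** p = p) ->
  (forall p q, p \in ps -> q \in ps -> p ** q = q ** p) ->
  forall p, p \in ps -> p ** proj_sup ps = p.
Proof.
elim: ps => [|q ps IH] // idem comm p; rewrite in_cons /= /proj_join.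
have qq : q ** q = q by apply: idem; rewrite mem_head.
case/predU1P=> [-> | pps].
  by rewrite smulBr smulDr smulA qq addrK.
(* Moving [p] past [q] puts it next to the inner supremum, which absorbs it by induction; the terms
   [p ** q] and [q ** p] then cancel. *)
have -> : p ** (q + proj_sup ps - q ** proj_sup ps)
        = p ** q + p ** proj_sup ps - q ** (p ** proj_sup ps).
  rewrite smulBr smulDr !smulA; congr (_ - _ ** _).
  by apply: comm; rewrite ?mem_head // in_cons pps orbT.
rewrite IH // => [|u ups|u v ups vps].
- by rewrite [q ** p]comm ?mem_head ?in_cons ?pps ?orbT// addrAC subrr add0r.
- by apply: idem; rewrite in_cons ups orbT.
- by apply: comm; rewrite in_cons ?ups ?vps orbT.
Qed.

Lemma proj_sup_annihil x ps :
  (forall p, p \in ps -> p ** x = 0) -> proj_sup ps ** x = 0.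
Proof.
elim: ps => [|p ps IH] px /=; first by rewrite smul0l.
rewrite /proj_join smulBl smulDl -smulA IH => [|q qps]; last first.
  by apply: px; rewrite in_cons qps orbT.
by rewrite px ?mem_head // smul0r !addr0 subr0.
Qed.

End StarAlgebraLemmas.

(** * Weighted variants of the canonical map out of the free star-algebra *)

Section WeightedCanonicalMap.
Variables (C : numClosedFieldType) (X : starAlgType C) (G : set X).
Local Notation word := ({fmonom (letter G)}).
Local Notation alg := (word_alg G).

(** Words are rescaled before the canonical map is applied. For [c w = a ^ deg w] with [a] nonzero
    the rescaling is a gauge action on the free algebra, the tool for telling degrees apart. *)
Definition weighted_map (c : word -> C) (f : alg) : X :=
  \sum_(w <- msupp f) (f@_w * c w) *: word_val w.

Lemma weighted_mapEw c (D : {fset word}) f : (msupp f `<=` D)%fset ->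
  weighted_map c f = \sum_(w <- D) (f@_w * c w) *: word_val w.
Proof.
move=> le; rewrite [LHS](big_fset_incl _ le) => //= w _ /mcoeff_outdom ->.
by rewrite mul0r scale0r.
Qed.

Lemma weighted_mapU c a w :
  weighted_map c << a *g w >> = (a * c w) *: word_val w.
Proof. by rewrite (weighted_mapEw c msuppU_le) big_seq_fset1 mcoeffUU. Qed.

Lemma weighted_mapD c : {morph weighted_map c : f g / f + g}.
Proof.
move=> f g.
rewrite (weighted_mapEw c (msuppD_le f g)).
rewrite (weighted_mapEw c (fsubsetUl (msupp f) (msupp g))).
rewrite (weighted_mapEw c (fsubsetUr (msupp f) (msupp g))).
rewrite -big_split; apply: eq_bigr => w _ /=.
by rewrite mcoeffD mulrDl scalerDl.
Qed.

Lemma weighted_map0 c : weighted_map c 0 = 0.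
Proof. by rewrite /weighted_map msupp0 big_seq_fset0. Qed.

Lemma weighted_map_sum c I (r : seq I) (Q : pred I) (F : I -> alg) :
  weighted_map c (\sum_(i <- r | Q i) F i)
  = \sum_(i <- r | Q i) weighted_map c (F i).
Proof. by apply: big_morph; [exact: weighted_mapD | exact: weighted_map0]. Qed.

Lemma weighted_mapZ c a f : weighted_map c (a *: f) = a *: weighted_map c f.
Proof.
rewrite (weighted_mapEw c (msuppZ_le a f)) scaler_sumr.
by apply: eq_bigr => w _; rewrite mcoeffZ scalerA mulrA.
Qed.

Lemma canonical_map_weighted f : canonical_map f = weighted_map (fun=> 1) f.
Proof. by apply: eq_bigr => w _; rewrite mulr1. Qed.

Lemma free_nuP f :
  free_nu f <-> (forall w, w \in msupp f -> (w : seq (letter G)) <> [::]).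
Proof.
split=> [f0 w wf w0|fn].
  have w1 : w = fmone (letter G) by apply/eqP; rewrite fmoneE fmP w0.
  by move: wf; rewrite -mcoeff_neq0 w1 f0 eqxx.
apply: contrapT => /eqP; rewrite mcoeff_neq0 => /fn; apply.
by rewrite fmoneE.
Qed.

Lemma free_nu_sum I (r : seq I) (Q : pred I) (F : I -> alg) :
  (forall i, Q i -> free_nu (F i)) -> free_nu (\sum_(i <- r | Q i) F i).
Proof.
move=> FQ; rewrite /free_nu/= raddf_sum big1 // => i Qi; exact: (FQ i Qi).
Qed.

Lemma free_nuU a (w : word) :
  (w : seq (letter G)) <> [::] -> free_nu (<< a *g w >> : alg).
Proof.
move=> w0; apply/free_nuP => v; move/(fsubsetP msuppU_le).
by rewrite inE => /eqP ->.
Qed.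

Lemma foldl_letter_val a x (s : seq (letter G)) :
  foldl (fun b m => b ** letter_val m) (a ** x) s
  = a ** foldl (fun b m => b ** letter_val m) x s.
Proof. by elim: s x => //= l s IH x; rewrite -smulA IH. Qed.

(** Both words must be nonempty because [word_val] takes the default value 0, not a unit, at the
    empty word. *)
Lemma word_valM (v w : word) :
  (v : seq (letter G)) <> [::] -> (w : seq (letter G)) <> [::] ->
  word_val (mmul v w) = word_val v ** word_val w.
Proof.
rewrite /word_val fmM; case: (v : seq _) => // l s _.
case: (w : seq _) => // m t _ /=.
by rewrite foldl_cat /= foldl_letter_val.
Qed.

Lemma word_val_cons l (s : seq (letter G)) : s <> [::] ->
  word_val (FMonom (l :: s)) = letter_val l ** word_val (FMonom s).
Proof. by case: s => // m s _; rewrite /word_val /= foldl_letter_val. Qed.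

Lemma word_val_rcons l (s : seq (letter G)) : s <> [::] ->
  word_val (FMonom (rcons s l)) = word_val (FMonom s) ** letter_val l.
Proof. by case: s => // m s _; rewrite /word_val /= foldl_rcons. Qed.

Lemma word_val_star (w : word) :
  (w : seq (letter G)) <> [::] -> word_val (word_star w) = star (word_val w).
Proof.
case: w => s /= s0; rewrite /word_star /=.
elim: s s0 => // l [|m s] IH _.
  by case: l => g [] /=; rewrite /word_val /= /letter_val /= ?starK.
rewrite map_cons rev_cons word_val_rcons; last first.
  by move/(congr1 size); rewrite size_rev.
rewrite IH // (word_val_cons l) // starM; congr (_ ** _).
by case: l => g [] /=; rewrite /letter_val /= ?starK.
Qed.

Lemma weighted_mapM c f g :
  (forall v w, c (mmul v w) = c v * c w) -> free_nu f -> free_nu g ->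
  weighted_map c (f * g) = weighted_map c f ** weighted_map c g.
Proof.
move=> cM /free_nuP f0 /free_nuP g0.
rewrite malgME weighted_map_sum smul_suml big_seq [RHS]big_seq.
apply: eq_bigr => v vf; rewrite weighted_map_sum smul_sumr big_seq [RHS]big_seq.
apply: eq_bigr => w wg; rewrite weighted_mapU cM.
rewrite word_valM; [|exact: f0|exact: g0].
by rewrite smulZl smulZr scalerA mulrACA.
Qed.

(** Two weights occur because the adjoint changes the sign of the degree: the gauge weight by [a]
    corresponds to the one by the inverse of the conjugate of [a]. *)
Lemma weighted_map_star c c' f :
  (forall w, c (word_star w) = (c' w)^*) -> free_nu f ->
  weighted_map c (free_star f) = star (weighted_map c' f).
Proof.
move=> cc' /free_nuP f0; rewrite weighted_map_sum star_sum big_seq [RHS]big_seq.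
apply: eq_bigr => w wf; rewrite weighted_mapZ weighted_mapU mul1r cc' scalerA.
by rewrite word_val_star ?starZ ?rmorphM//; exact: f0.
Qed.

Lemma free_nuM f g : free_nu f -> free_nu (f * g : alg).
Proof.
move=> /free_nuP f0; apply/free_nuP => w /msuppM_le [v [v' [/f0 + _ ->]]].
by rewrite fmM; case: (v : seq _).
Qed.

Lemma free_nu_star f : free_nu f -> free_nu (free_star f : alg).
Proof.
move=> /free_nuP f0; rewrite /free_star big_seq; apply: free_nu_sum => w wf.
rewrite /free_nu /= mcoeffZ [X in _ * X](_ : _ = 0) ?mulr0 //.
apply: free_nuU => /(congr1 size); rewrite /word_star /= size_rev size_map.
by move/size0nil; apply: f0.
Qed.

End WeightedCanonicalMap.

(** * Fiber relations keep words of different degrees apart *)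

Section Grading.
Variables (C : numClosedFieldType) (X : starAlgType C) (k : Type).
Variables (G : set X) (dg : X -> k -> nat) (S : set (word_alg G)).
Hypothesis S_fiber : S `<=` fiber_space dg.
Hypothesis S_ker : forall f, free_nu f ->
  (canonical_map f = 0 <-> star_ideal_gen S f).
Variable i : k.
Local Notation word := ({fmonom (letter G)}).

Lemma word_degM (v w : word) :
  word_deg dg (mmul v w) i = word_deg dg v i + word_deg dg w i.
Proof. by rewrite /word_deg fmM big_cat. Qed.

Lemma word_deg_star (w : word) :
  word_deg dg (word_star w) i = - word_deg dg w i.
Proof.
rewrite /word_deg /word_star /=.
rewrite (perm_big _ (permEl (perm_rev _))) big_map -sumrN.
by apply: eq_bigr => l _ /=; rewrite -mulNr; case: l.2; rewrite ?expr1 ?opprK.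
Qed.

Let tau (a : C) (w : word) : C := a ^ word_deg dg w i.

Lemma fiber_space_free_nu : S `<=` @free_nu C X G.
Proof.
move=> f /S_fiber [n [s [sn ->]]]; rewrite big_seq.
apply: free_nu_sum => cw cws.
rewrite /free_nu /= mcoeffZ [X in _ * X](_ : _ = 0) ?mulr0 //.
by apply: free_nuU; have [] := sn _ cws.
Qed.

(** On a single fiber the weight is the constant [a ^ n i], so the weighted map is this multiple of
    the canonical map, which kills every relation in [S]. *)
Lemma weighted_map_fiber a f : S f -> weighted_map (tau a) f = 0.
Proof.
move=> Sf; have : canonical_map f = 0.
  by apply/(S_ker (fiber_space_free_nu Sf)) => J _; apply.
have [n [s [sn ->]]] := S_fiber Sf.
rewrite canonical_map_weighted !weighted_map_sum => H.
transitivity (a ^ n i *: (0 : X)); last by rewrite scaler0.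
rewrite -[X in _ *: X]H scaler_sumr big_seq [RHS]big_seq.
apply: eq_bigr => cw cws; rewrite !weighted_mapZ !weighted_mapU /tau.
have [_ ->] := sn _ cws.
by rewrite !mul1r scale1r scalerA scalerA mulrC.
Qed.

(* The weights [2 ^ deg] and [2 ^ - deg] are exchanged by the involution, so
   that only the intersection of the two kernels is a star-ideal. *)
Lemma weighted_map_ker f : free_nu f -> canonical_map f = 0 ->
  weighted_map (tau 2) f = 0.
Proof.
move=> f0 /(S_ker f0) Sf.
have tauM a : a != 0 -> forall v w, tau a (mmul v w) = tau a v * tau a w.
  by move=> a0 v w; rewrite /tau word_degM expfzDr.
have two : (2 : C) != 0 by rewrite pnatr_eq0.
have twoV : (2 : C)^-1 != 0 by rewrite invr_eq0.
have star2 (w : word) : tau 2 (word_star w) = (tau 2^-1 w)^*.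
  rewrite /tau word_deg_star exprz_inv.
  by rewrite fmorphXz rmorph_nat.
have star2V (w : word) : tau 2^-1 (word_star w) = (tau 2 w)^*.
  by rewrite /tau word_deg_star exprz_inv opprK fmorphXz rmorph_nat.
have [] // := Sf [set f | [/\ free_nu f, weighted_map (tau 2) f = 0
                            & weighted_map (tau 2^-1) f = 0]].
  split.
  - by move=> g [].
  - by rewrite /= !weighted_map0; split=> //; rewrite /free_nu /= mcoeff0.
  - move=> g h [g0 g2 g2V] [h0 h2 h2V]; split; last 2 first.
    + by rewrite weighted_mapD g2 h2 addr0.
    + by rewrite weighted_mapD g2V h2V addr0.
    by rewrite /free_nu /= mcoeffD g0 h0 addr0.
  - move=> a g [g0 g2 g2V]; split; rewrite ?weighted_mapZ ?g2 ?g2V ?scaler0 //.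
    by rewrite /free_nu /= mcoeffZ g0 mulr0.
  - move=> g h g0 [h0 h2 h2V]; split; first exact: free_nuM.
    + by rewrite weighted_mapM ?h2 ?smul0r //; exact: tauM.
    + by rewrite weighted_mapM ?h2V ?smul0r //; exact: tauM.
  - move=> g h [g0 g2 g2V] h0; split; first exact: free_nuM.
    + by rewrite weighted_mapM ?g2 ?smul0l //; exact: tauM.
    + by rewrite weighted_mapM ?g2V ?smul0l //; exact: tauM.
  - move=> g [g0 g2 g2V]; split; first exact: free_nu_star.
    + by rewrite (weighted_map_star star2) // g2V star0.
    + by rewrite (weighted_map_star star2V) // g2 star0.
move=> g Sg; split; [exact: fiber_space_free_nu| |]; exact: weighted_map_fiber.
Qed.

(** The difference of the two words is in the kernel of the canonical map, hence in that of the map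
    weighted by [tau 2]. This makes [2 ^ deg v - 1] times the common value vanish, and the scalar is
    nonzero since the degree is positive. *)
Lemma word_val_homogeneous (v w : word) :
  (v : seq (letter G)) <> [::] -> (w : seq (letter G)) <> [::] ->
  (0 < word_deg dg v i) -> word_deg dg w i = 0 ->
  word_val v = word_val w -> word_val v = 0.
Proof.
move=> v0 w0 dv dw vw.
pose f : word_alg G := << 1 *g v >> + (-1) *: << 1 *g w >>.
have f0 : free_nu f.
  by rewrite /free_nu /= mcoeffD mcoeffZ !free_nuU ?mulr0 ?addr0.
have fc c : weighted_map c f = (c v - c w) *: word_val w.
  rewrite weighted_mapD weighted_mapZ !weighted_mapU vw scalerA -scalerDl.
  by rewrite !mul1r mulN1r.
have /weighted_map_ker : canonical_map f = 0.
  by rewrite canonical_map_weighted fc subrr scale0r.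
move=> /(_ f0); rewrite fc vw /tau dw expr0z => /eqP.
rewrite scaler_eq0 => /orP[|/eqP //].
case: (word_deg dg v i) dv => // n n0.
by rewrite subr_eq0 -exprnP gt_eqF // exprn_egt1 ?ltr1n -?lt0n.
Qed.
End Grading.

(** * Half-standard words and their range projections *)

Section SemigraphAlgebraLemmas.
Variables (C : numClosedFieldType) (X : starAlgType C) (k : Type).
Variables (P T : set X) (d : X -> k -> nat).
Hypothesis H : semigraph_algebra P T d.
Local Notation T1 := (adjoin_unit (gen_magma T)).
Local Notation d1 := (deg1 d).
Implicit Types (a b p q r s t u x y : X) (al be : option X).

Lemma P_star p : P p -> star p = p.
Proof. by case/(sga_P_proj H). Qed.

Lemma P_idem p : P p -> p ** p = p.
Proof. by case/(sga_P_proj H). Qed.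

Lemma P_mul p q : P p -> P q -> P (p ** q).
Proof. exact: (sga_P_mul H). Qed.

Lemma P_comm p q : P p -> P q -> p ** q = q ** p.
Proof. exact: (sga_P_comm H). Qed.

(** Both [al 1] and [1 al] factor [al] along the decomposition 0 = 0 + 0, so uniqueness identifies
    them. *)
Lemma deg0_unit al : carrier T1 al -> (forall i, d1 al i = 0%N) -> al = None.
Proof.
move=> Tal d0.
have [|w [_ uniq_w]] := ksemigraph_fact (sga_T_semigraph H) (x := al)
  (n1 := fun=> 0%N) (n2 := fun=> 0%N) Tal; first by move=> i; rewrite d0.
have w1 : w = (al, None) by apply: uniq_w; split=> //=; case: (al).
have w2 : w = (None, al) by apply: uniq_w; split=> //=; case: (al).
by case: (etrans (esym w1) w2).
Qed.

Lemma deg1_mul al be : carrier T1 al -> carrier T1 be -> composable T1 al be ->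
  forall i, d1 (pmul T1 al be) i = (d1 al i + d1 be i)%N.
Proof. exact: (ksemigraph_deg (sga_T_semigraph H)). Qed.

Lemma star_mul_T s t : T s -> T t ->
  exists (L : seq (option X * option X)) (q : option X * option X -> X),
  [/\ forall ab, ab \in L -> Tmin T1 d1 (Some s) (Some t) ab,
      forall ab, ab \in L -> P (q ab) &
      star s ** t = \sum_(ab <- L) lact1 ab.1 (ract1_star (q ab) ab.2)].
Proof.
move=> Ts Tt; have [q [Pq ->]] := sga_star_mul H Ts Tt.
set F := fun ab : option X * option X => lact1 ab.1 (ract1_star (q ab) ab.2).
set M := Tmin _ _ _ _.
(* The sum over [M] is by definition a sum over this list, which is empty by default when the
   support is infinite; hence the two cases. *)
exists (finite_support 0 M F), q; split=> [ab|ab|//].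
- have [fin|nfin] := pselect (finite_set (M `&` F @^-1` [set~ 0])).
    by rewrite in_finite_support // => /set_mem[].
  by rewrite no_finite_support.
- have [fin|nfin] := pselect (finite_set (M `&` F @^-1` [set~ 0])).
    by rewrite in_finite_support // => /set_mem[/Pq].
  by rewrite no_finite_support.
Qed.

(** A minimal common extension of [t] with itself has degree [d t], so both completing factors have
    degree 0 and equal the unit. The sum for [t^* t] thus has one term, an element of [P]. *)
Lemma Q_in_P t : T t -> P (star t ** t).
Proof.
move=> Tt; have [q [Pq]] := sga_star_mul H Tt Tt.
set M := Tmin _ _ _ _ in Pq *.
have MN : M = [set (None, None)].
  have unit_of be : carrier T1 be -> composable T1 (Some t) be ->
      (forall i, d1 (pmul T1 (Some t) be) i = maxn (d t i) (d t i)) ->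
      be = None.
    move=> Tbe tbe dbe; apply: deg0_unit => // i; have := dbe i.
    rewrite deg1_mul //= maxnn => /eqP.
    by rewrite -{2}[d t i]addn0 eqn_add2l => /eqP.
  rewrite eqEsubset; split=> [[al be] [[/= Tal Tbe] [tal tbe] tt dd]|_ ->].
    have -> : al = None by exact: unit_of.
    suff -> : be = None by [].
    by apply: unit_of => // i; rewrite -dd; congr (d1 _ i); exact: (esym tt).
  by split=> //= i; rewrite maxnn.
rewrite MN fsbig_set1 /= => ->; apply: Pq; by rewrite MN.
Qed.

Definition rmul1 s al : X := if al is Some a then s ** a else s.

Lemma pmul_rmul1 s al : pmul T1 (Some s) al = Some (rmul1 s al).
Proof. by case: al. Qed.

Lemma smul_lact1 s al x : s ** lact1 al x = rmul1 s al ** x.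
Proof. by case: al => //= a; rewrite smulA. Qed.

Lemma lact1_smul al x y : lact1 al x ** y = lact1 al (x ** y).
Proof. by case: al => //= a; rewrite smulA. Qed.

Lemma smul_ract1_star al x y : x ** ract1_star y al = ract1_star (x ** y) al.
Proof. by case: al => //= a; rewrite smulA. Qed.

Lemma ract1_star_smul t be x :
  ract1_star x be ** star t = x ** star (rmul1 t be).
Proof. by case: be => //= b; rewrite starM smulA. Qed.

Lemma swap1 p al : P p -> carrier T1 al ->
  exists2 q, P q & forall x, p ** lact1 al x = lact1 al (q ** x).
Proof.
case: al => [a|] Pp /= Ta; last by exists p.
have [q Pq pa] := sga_swap H Ta Pp.
by exists q => // x; rewrite !smulA pa.
Qed.

Lemma swap1_star p be : P p -> carrier T1 be ->
  exists2 q, P q & forall x, ract1_star x be ** p = ract1_star (x ** q) be.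
Proof.
case: be => [b|] Pp /= Tb; last by exists p.
have [q Pq pb] := sga_swap H Tb Pp.
exists q => // x; rewrite -!smulA; congr (_ ** _).
by have /(congr1 star) := pb; rewrite !starM (P_star Pp) (P_star Pq).
Qed.

Lemma half_standard_P p : P p -> half_standard P T p.
Proof. by exists None, p. Qed.

Lemma half_standard_TP t p : T t -> P p -> half_standard P T (t ** p).
Proof. by exists (Some t), p. Qed.

(** The swap relation [q s = s q'] brings [s^*] and [s] together, which leaves a product of elements
    of [P]. *)
Lemma half_standard_conj x q :
  half_standard P T x -> P q -> P (star x ** q ** x).
Proof.
case=> -[s|] [p [/= Ts Pp ->]] Pq; rewrite /=; last first.
  by rewrite P_star //; exact: P_mul (P_mul Pp Pq) Pp.
have [q' Pq' qs] := sga_swap H Ts Pq.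
have -> : star (s ** p) ** q ** (s ** p) = p ** ((star s ** s) ** q') ** p.
  by rewrite starM P_star // !smulA -(smulA _ q s) qs !smulA.
exact: P_mul (P_mul Pp (P_mul (Q_in_P Ts) Pq')) Pp.
Qed.

Lemma half_standard_Q x : half_standard P T x -> P (star x ** x).
Proof.
case=> -[s|] [p [/= Ts Pp ->]] /=; last by rewrite P_star // P_idem.
have -> : star (s ** p) ** (s ** p) = p ** (star s ** s) ** p.
  by rewrite starM P_star // !smulA.
exact: P_mul (P_mul Pp (Q_in_P Ts)) Pp.
Qed.

(** A normal form: [p] may be replaced by the source projection of the word, because [p] commutes
    with [s^* s] and [s] absorbs [s^* s]. The compressions below are computed in this form. *)
Lemma half_standard_Q_repr (s : option X) p : carrier T1 s -> P p ->
  let x := lact1 s p in x = lact1 s (star x ** x).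
Proof.
case: s => [s|] /= Ts Pp; last by rewrite P_star // P_idem.
have sss : s ** star s ** s = s by exact: (sga_T_piso H).
have -> : star (s ** p) ** (s ** p) = (star s ** s) ** (p ** p).
  rewrite starM P_star // -!smulA [star s ** (s ** p)]smulA smulA.
  by rewrite (P_comm Pp (Q_in_P Ts)) !smulA.
by rewrite P_idem // !smulA sss.
Qed.

Lemma half_standard_piso x : half_standard P T x -> x ** (star x ** x) = x.
Proof.
case=> s [p [Ts Pp xE]]; rewrite {4}xE (half_standard_Q_repr Ts Pp) -xE.
have {1}-> : x = lact1 s (star x ** x).
  by rewrite {1}xE (half_standard_Q_repr Ts Pp) -xE.
by rewrite lact1_smul P_idem //; apply: half_standard_Q; exists s, p.
Qed.

Lemma Pr_idem x : half_standard P T x -> Pr x ** Pr x = Pr x.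
Proof. by move=> Hx; rewrite /Pr smulA -(smulA x) half_standard_piso. Qed.

(* The range projection of a product of words is a sum of elements [c q c^*]
   with [c = s alpha = t beta], hence self-adjoint. *)
Lemma Pr_comm x y : half_standard P T x -> half_standard P T y ->
  Pr x ** Pr y = Pr y ** Pr x.
Proof.
have selfadj x' y' : star (Pr x' ** Pr y') = Pr x' ** Pr y' ->
    Pr x' ** Pr y' = Pr y' ** Pr x' by rewrite starM !star_Pr.
have PT p t q : P p -> T t -> P q -> Pr p ** Pr (t ** q) = Pr (t ** q) ** Pr p.
  move=> Pp Tt Pq; apply: selfadj.
  have [p' Pp' pt] := sga_swap H Tt Pp.
  have -> : Pr p ** Pr (t ** q) = t ** (p' ** q) ** star t.
    rewrite (Pr_proj (sga_P_proj H Pp)) /Pr starM P_star // !smulA pt.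
    by rewrite -(smulA _ q q) P_idem.
  by rewrite !starM starK P_star // (P_star Pp') (P_comm Pq Pp') !smulA.
case=> -[s|] [p [/= Ts Pp ->]]; case=> -[t|] [q [/= Tt Pq ->]] /=.
- apply: selfadj.
  have -> : Pr (s ** p) ** Pr (t ** q) = s ** p ** (star s ** t) ** q ** star t.
    rewrite /Pr !starM (P_star Pp) (P_star Pq) !smulA.
    rewrite -(smulA s p p) (P_idem Pp).
    by rewrite -(smulA _ q q) (P_idem Pq).
  have [L [r [ML Pr_ ->]]] := star_mul_T Ts Tt.
  rewrite smul_sumr !smul_suml star_sum big_seq [RHS]big_seq.
  apply: eq_bigr => -[al be] abL.
  have [/= [Tal Tbe] _ stE _] := ML _ abL; have Prab := Pr_ _ abL.
  have [p' Pp' pal] := swap1 Pp Tal; have [q' Pq' qbe] := swap1_star Pq Tbe.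
  have cE : rmul1 s al = rmul1 t be.
    by apply: Some_inj; rewrite -!pmul_rmul1; exact: stE.
  rewrite /= -(smulA s) pal smul_lact1 smul_ract1_star.
  rewrite -(smulA (rmul1 s al)) qbe.
  rewrite -smulA ract1_star_smul -cE.
  have Pu : P (p' ** (r (al, be) ** q')) by exact: P_mul Pp' (P_mul Prab Pq').
  rewrite -(smulA p') starM (starM (p' ** _)) starK (P_star Pu).
  exact/esym/smulA.
- by apply/esym; exact: PT.
- exact: PT.
- by rewrite !(Pr_proj (sga_P_proj H _)) // P_comm.
Qed.

Lemma sum_range_proj (I : eqType) (L : seq I) (F : I -> X) (K : X -> Prop) :
  (forall j, j \in L -> exists2 a, K a & F j = Pr a) ->
  exists2 as_ : seq X, (forall a, a \in as_ -> K a) &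
    \sum_(j <- L) F j = \sum_(a <- as_) Pr a.
Proof.
elim: L => [_|j L IH FK]; first by exists [::]; rewrite ?big_nil.
have [a Ka Fa] := FK j (mem_head _ _).
have [j' jL|as_ Kas sumE] := IH; first by apply: FK; rewrite in_cons jL orbT.
exists (a :: as_) => [b|]; last by rewrite !big_cons Fa sumE.
by rewrite in_cons => /predU1P[->|/Kas].
Qed.

(** * Compression of range projections by a half-standard word *)

Definition divides1 be al : Prop :=
  exists ga, [/\ carrier T1 ga, composable T1 be ga & al = pmul T1 be ga].

(* The cross terms [beta^* beta'] never have to be computed, because
   [t beta = s alpha] turns [beta^* t^* s] into [alpha^* s^* s]. *)
Lemma conj_range_proj (s t : option X) p q :
  carrier T1 s -> carrier T1 t -> P p -> P q ->
  let x := lact1 s p in let y := lact1 t q in let p0 := star x ** x in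
  (divides1 t s -> P (star x ** Pr y ** x)) /\
  (~ divides1 t s -> exists2 as_ : seq X,
     (forall a, a \in as_ -> p0 ** a = a /\
        exists b u, [/\ T b, P u & a = b ** u]) &
     star x ** Pr y ** x = \sum_(a <- as_) Pr a).
Proof.
move=> Ts Tt Pp Pq x y p0.
have Hx : half_standard P T x by exists s, p.
have Pp0 : P p0 by exact: half_standard_Q.
have xE : x = lact1 s p0 by exact: half_standard_Q_repr.
split=> [[ga [Tga tga sE]]|ndiv].
  (* Here [x = t w]. For [t] in [T] the inner compression [t^* P_y t] is already in [P], so only a
     compression by [w] remains. *)
  pose w := lact1 ga p.
  have Hw : half_standard P T w by exists ga, p.
  case: t Tt @y tga sE => [t|] Tt y tga sE; last first.
    have -> : x = w by rewrite /x sE /w; case: (ga).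
    rewrite /y /= (Pr_proj (sga_P_proj H Pq)); exact: half_standard_conj.
  have -> : x = t ** w by rewrite smul_lact1 /x sE pmul_rmul1.
  rewrite /y /=.
  have -> : star (t ** w) ** Pr (t ** q) ** (t ** w)
          = star w ** ((star t ** t) ** q ** (star t ** t)) ** w.
    by rewrite /Pr !starM (P_star Pq) !smulA -(smulA _ q q) P_idem.
  apply: half_standard_conj => //.
  have PQ := Q_in_P Tt.
  exact: P_mul (P_mul PQ Pq) PQ.
have p0E : p0 = star x ** x by [].
clearbody p0 x.
case: t Tt @y ndiv => [t|] Tt y ndiv; last first.
  by case: ndiv; exists s; split=> //; case: (s).
have {}Tt : T t by [].
(* For [s = 1] the word [x] is [p0] itself, and the compression is the range projection of
   [p0 y = t p' q]. *)
case: s Ts xE ndiv => [s|] Ts xE ndiv; last first.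
  have [p' Pp' pt] := sga_swap H Tt Pp0.
  exists [:: t ** (p' ** q)] => [a|]; last first.
    have -> : t ** (p' ** q) = p0 ** y by rewrite /y /= !smulA pt.
    by rewrite big_seq1 xE /= /Pr starM (P_star Pp0) !smulA.
  rewrite mem_seq1 => /eqP ->; split.
    by rewrite !smulA pt -!smulA; congr (_ ** _); rewrite smulA P_idem.
  by exists t, (p' ** q); split=> //; exact: P_mul.
have {}Ts : T s by [].
have p0Q : star s ** s ** p0 = p0.
  rewrite [RHS]p0E xE /= starM (P_star Pp0) !smulA -(smulA p0 (star s)).
  by rewrite (P_comm Pp0 (Q_in_P Ts)) -(smulA _ p0 p0) P_idem.
have [L [r [ML Prr stE]]] := star_mul_T Ts Tt.
have -> : star x ** Pr y ** x = \sum_(ab <- L)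
    p0 ** lact1 ab.1 (ract1_star (r ab) ab.2) ** q ** star t ** s ** p0.
  rewrite xE /Pr /y !starM (P_star Pp0) (P_star Pq).
  transitivity (p0 ** (star s ** t) ** q ** star t ** s ** p0).
    by rewrite !smulA -(smulA _ q q) P_idem.
  by rewrite stE smul_sumr !smul_suml.
apply: sum_range_proj => -[al be] abL.
have [/= [Tal Tbe] [_ tbe] stE' _] := ML _ abL; have Prab := Prr _ abL.
(* A term with [alpha = 1] would say [s = t beta], contrary to non-divisibility. *)
case: al Tal abL stE' Prab => [al|] /= Tal abL stE' Prab; last first.
  by case: ndiv; exists be; split.
have [p' Pp' pal] := sga_swap H Tal Pp0.
have [q' Pq' qbe] := swap1_star Pq Tbe.
have cE : s ** al = rmul1 t be by case: (be) stE' => [b|] [].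
pose w := r (Some al, be) ** q'; have Pw : P w by exact: P_mul.
have Pu : P (p' ** w) by exact: P_mul.
exists (al ** (p' ** w)).
  split; last by exists al, (p' ** w).
  by rewrite !smulA pal -(smulA al p' p') P_idem.
have palS : star al ** p0 = p' ** star al.
  by have /(congr1 star) := pal; rewrite !starM (P_star Pp0) (P_star Pp').
transitivity (p0 ** al ** w ** star al ** (star s ** s ** p0)).
  rewrite -!smulA; congr (_ ** (_ ** _)).
  rewrite !smulA qbe ract1_star_smul -cE.
  by rewrite starM !smulA.
have uE : p' ** w ** p' = p' ** w.
  by rewrite -smulA (P_comm Pw Pp') smulA P_idem.
rewrite p0Q -(smulA _ (star al) p0) palS pal /Pr starM (P_star Pu).
transitivity (al ** (p' ** w ** p') ** star al); first by rewrite !smulA.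
rewrite uE; transitivity (al ** ((p' ** w) ** (p' ** w)) ** star al).
  by rewrite (P_idem Pu).
by rewrite !smulA.
Qed.

(** The same element is the value of the two-letter word [a u], of positive degree in some
    direction, and of a single letter from [P], of degree 0. *)
Lemma TP_inter_P a u : T a -> P u -> P (a ** u) -> a ** u = 0.
Proof.
move=> Ta Pu Pau; have [S S_fib S_ker] := sga_fiber H.
have [i di] : exists i, d a i <> 0%N.
  apply: contrapT => /forallNP d0.
  have : Some a = None by apply: deg0_unit => // i; apply: contrapT; exact: d0.
  by [].
have memP x : P x -> x \in P `|` T by move=> Px; apply/mem_set; left.
have memT x : T x -> x \in P `|` T by move=> Tx; apply/mem_set; right.
have PnT x : P x -> x \in T = false.
  move=> Px; apply/negbTE/negP => /set_mem Tx.
  by have : (P `&` T) x by []; rewrite (sga_disjoint H).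
pose l x (xPT : x \in P `|` T) : letter (P `|` T) := (SigSub xPT, false).
pose v := FMonom [:: l a (memT a Ta); l u (memP u Pu)].
pose w := FMonom [:: l _ (memP _ Pau)].
have := @word_val_homogeneous _ _ _ _ _ _ S_fib S_ker i v w.
apply=> //.
- rewrite /word_deg big_cons big_seq1 /= !expr0 !mul1r /gen_deg /=.
  rewrite (mem_set Ta) (PnT u Pu) addr0.
  by rewrite ltz_nat lt0n; apply/eqP.
- by rewrite /word_deg big_seq1 /= expr0 mul1r /gen_deg (PnT _ Pau).
Qed.

End SemigraphAlgebraLemmas.

(** * Consequences of freeness for compressed range projections *)

Section FreeSemigraphAlgebraLemmas.
Variables (C : numClosedFieldType) (X : starAlgType C) (k : Type).
Variables (P T : set X) (d : X -> k -> nat).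
Hypothesis H : semigraph_algebra P T d.
Hypothesis free : free_semigraph_algebra P T.
Implicit Types (a b p q t u x y g : X) (ys : seq X).

Lemma Pr_TP_lt p0 b u : P p0 -> p0 <> 0 -> T b -> P u ->
  p0 ** (b ** u) = b ** u -> proj_lt (Pr (b ** u)) p0.
Proof.
move=> Pp0 p0N0 Tb Pu p0a; split.
  by rewrite /proj_le /Pr -smulA -(P_star H Pp0) -starM p0a.
move=> PrE; have [Pa|nPa] := pselect (P (b ** u)).
  by apply: p0N0; rewrite -PrE (TP_inter_P H Tb Pu Pa) /Pr smul0l.
by apply: (free.1 _ (half_standard_TP Tb Pu) nPa); rewrite PrE.
Qed.

Lemma free_sup_lt p0 (as_ : seq X) : P p0 -> p0 <> 0 ->
  (forall a, a \in as_ -> half_standard P T a /\ proj_lt (Pr a) p0) ->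
  proj_lt (proj_sup [seq Pr a | a <- as_]) p0.
Proof.
(* The freeness condition concerns nonempty families; the empty supremum is 0, which is strictly
   below [p0] because [p0] is nonzero. *)
case: as_ => [|a0 as_] Pp0 p0N0 Has.
  by split; [rewrite /proj_le /= smul0l | exact: nesym].
have := free.2 p0 (size as_) (fun j => nth 0 (a0 :: as_) (nat_of_ord j)) Pp0.
have -> : [seq Pr (nth 0 (a0 :: as_) (nat_of_ord j))
              | j <- enum 'I_(size as_).+1]
        = [seq Pr a | a <- a0 :: as_].
  rewrite (map_comp (fun a => Pr a)) (map_comp (nth 0 _) (@nat_of_ord _)).
  rewrite val_enum_ord.
  by rewrite (map_nth_iota0 _ (leqnn (size (a0 :: as_)))) take_size.
by apply=> j; have /Has[] := mem_nth 0 (ltn_ord j : j < size (a0 :: as_))%N.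
Qed.

Section Compression.
Variables (s : option X) (p : X).
Hypotheses (Ts : carrier (adjoin_unit (gen_magma T)) s) (Pp : P p).
Local Notation x := (lact1 s p).
Local Notation p0 := (star x ** x).

(** These are the words whose compression by [x] is within reach of the second freeness condition.
    The sum enters only through its annihilator: whatever all the [P_a] kill, it kills. *)
Definition compressed y : Prop := exists2 as_ : seq X,
  (forall a, a \in as_ ->
     [/\ half_standard P T a, p0 ** a = a & proj_lt (Pr a) p0]) &
  star x ** Pr y ** x = \sum_(a <- as_) Pr a.

(** Merging the lists of all the words allows a single supremum to handle all of [ys] at once. *)
Lemma compressed_seq ys : (forall y, y \in ys -> compressed y) ->
  exists2 as_ : seq X,
    (forall a, a \in as_ ->
       [/\ half_standard P T a, p0 ** a = a & proj_lt (Pr a) p0]) &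
    forall g, (forall a, a \in as_ -> Pr a ** g = 0) ->
    forall y, y \in ys -> star x ** Pr y ** x ** g = 0.
Proof.
elim: ys => [_|y ys IH cys]; first by exists [::].
have [|as1 Has1 ann1] := IH.
  by move=> z zys; apply: cys; rewrite in_cons zys orbT.
have [as2 Has2 sumE] := cys y (mem_head _ _).
exists (as1 ++ as2) => [a|g ann z].
  by rewrite mem_cat => /orP[/Has1|/Has2].
rewrite in_cons => /predU1P[->|]; last first.
  apply: ann1 => a aas; apply: ann.
  by rewrite mem_cat aas.
rewrite sumE smul_suml big_seq big1 // => a aas.
by apply: ann; rewrite mem_cat aas orbT.
Qed.

Let Hx : half_standard P T x. Proof. by exists s, p. Qed.
Let Pp0 : P p0. Proof. exact: (half_standard_Q H Hx). Qed.

Lemma compressed_not_covering ys : p0 <> 0 ->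
  (forall y, y \in ys -> half_standard P T y /\ compressed y) ->
  exists g, [/\ x ** g <> 0 & forall y, y \in ys -> Pr y ** (x ** g) = 0].
Proof.
move=> p0N0 cys; have [|as_ Has ann] := @compressed_seq ys.
  by move=> y /cys[].
set S' := proj_sup [seq Pr a | a <- as_].
have [le_S lt_S] : proj_lt S' p0.
  by apply: free_sup_lt => // a /Has[].
have Pr_p0 a : a \in as_ -> Pr a ** p0 = Pr a by move=> /Has[_ _ []].
have p0_Pr a : a \in as_ -> p0 ** Pr a = Pr a.
  by move=> /Has[_ p0a _]; rewrite /Pr smulA p0a.
have comm_S : p0 ** S' = S' ** p0.
  by apply: proj_sup_comm => q /mapP[a aas ->]; rewrite Pr_p0 // p0_Pr.
(* This is the part of [p0] left uncovered by the supremum; it is orthogonal to every [P_a], and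
   nonzero by strictness. *)
pose g := p0 - S'.
have ann_g a : a \in as_ -> Pr a ** g = 0.
  move=> aas; rewrite smulBr Pr_p0 // proj_sup_ub ?subrr ?map_f //.
    by move=> q /mapP[b /Has[Hb _ _] ->]; exact: (Pr_idem H Hb).
  move=> q r /mapP[b /Has[Hb _ _] ->] /mapP[c /Has[Hc _ _] ->].
  exact: (Pr_comm H Hb Hc).
exists g; split.
  move=> xg0; apply: lt_S; apply/esym/eqP; rewrite -subr_eq0; apply/eqP.
  have : p0 ** g = 0 by rewrite -smulA xg0 smul0r.
  by rewrite smulBr (P_idem H Pp0) comm_S le_S.
move=> y yys; have [Hy _] := cys _ yys.
(* Commuting [Pr y] past the inserted [Pr x] exhibits the compression [x^* P_y x], which kills
   [g]. *)
transitivity (Pr y ** Pr x ** (x ** g)).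
  rewrite -smulA; congr (_ ** _).
  by rewrite smulA -(smulA x) (half_standard_piso H Hx).
rewrite (Pr_comm H Hy Hx) -(smulA (Pr x)) -(smulA x).
transitivity (x ** (star x ** Pr y ** x ** g)); first by rewrite !smulA.
by rewrite (ann g ann_g y yys) smul0r.
Qed.

Lemma compressed_nondiv (t : option X) q :
  carrier (adjoin_unit (gen_magma T)) t -> P q ->
  p0 <> 0 -> ~ divides1 T t s -> compressed (lact1 t q).
Proof.
move=> Tt Pq p0N0 ndiv.
have [_ /(_ ndiv)[as_ Has sumE]] := conj_range_proj H Ts Tt Pp Pq.
exists as_ => // a /Has[p0a [b [u [Tb Pu aE]]]]; rewrite aE in p0a *.
by split=> //; [exact: half_standard_TP | exact: Pr_TP_lt].
Qed.

(** The compression [r] lies in [P] below [p0]. If it is strictly below, [r] alone is an admissible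
    list, being its own range projection; if [r = p0], then [P_x] lies below [P_y]. *)
Lemma compressed_div (t : option X) q :
  carrier (adjoin_unit (gen_magma T)) t -> P q ->
  divides1 T t s ->
  compressed (lact1 t q) \/ Pr x ** Pr (lact1 t q) = Pr x.
Proof.
move=> Tt Pq div; have [/(_ div) Pr_ _] := conj_range_proj H Ts Tt Pp Pq.
set r := _ ** _ ** _ in Pr_ *.
have rE : Pr r = r by exact: Pr_proj (sga_P_proj H Pr_).
have p0x : p0 ** star x = star x.
  have /(congr1 star) := half_standard_piso H Hx.
  by rewrite starM (P_star H Pp0).
have [rp0|rNp0] := pselect (r = p0).
  right; have Hy : half_standard P T (lact1 t q) by exists t, q.
  rewrite -{1}(Pr_idem H Hx) -smulA (Pr_comm H Hx Hy).
  transitivity (x ** r ** star x); first by rewrite /Pr /r !smulA.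
  by rewrite rp0 (half_standard_piso H Hx).
left; exists [:: r] => [a|]; last by rewrite big_seq1 rE.
have p0r : p0 ** r = r by rewrite /r !smulA p0x.
rewrite mem_seq1 => /eqP ->; split=> //; first exact: half_standard_P.
by split; rewrite rE // /proj_le (P_comm H Pr_ Pp0).
Qed.

End Compression.
End FreeSemigraphAlgebraLemmas.

(** * From freeness to weak freeness *)

Theorem proposition3p9 (R : realType) (k : Type) (X : starAlgType R[i])
    (P T : set X) (d : X -> k -> nat) :
  semigraph_algebra P T d ->
  free_semigraph_algebra P T ->
  weakly_free P T d.
Proof.
move=> H free i e [x [ys [[s [p [Ts' Pp xE]]] Hys eE]]] e0 B BT eB.
have restr_carrier al :
    carrier (adjoin_unit (gen_magma (restr_gens T d i))) al ->
    carrier (adjoin_unit (gen_magma T)) al by case: al => //= t [].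
have Ts := restr_carrier _ Ts'.
have Hx : half_standard P T x by exists s, p.
rewrite foldl_mul_compl in eE; set S := proj_sup _ in eE.
have Hys' y : y \in ys -> half_standard P T y.
  by move=> /Hys[t [q [/restr_carrier Tt Pq ->]]]; exists t, q.
have p0N0 : star x ** x <> 0.
  move=> p00; apply: e0; rewrite eE.
  by rewrite /Pr -(half_standard_piso H Hx) p00 smul0r !smul0l subrr.
have S_ub y : y \in ys -> Pr y ** S = Pr y.
  move=> yys; apply: proj_sup_ub; last exact: map_f.
    by move=> _ /mapP[z /Hys' Hz ->]; exact: (Pr_idem H Hz).
  move=> _ _ /mapP[z /Hys' Hz ->] /mapP[w /Hys' Hw ->].
  exact: (Pr_comm H Hz Hw).
have c_ys y : y \in ys -> half_standard P T y /\ compressed P T s p y.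
  move=> yys; split; first exact: Hys'.
  have [t [q [/restr_carrier Tt Pq yE]]] := Hys _ yys.
  rewrite xE in p0N0; rewrite yE.
  have [div|] := pselect (divides1 T t s); last exact: (compressed_nondiv H).
  have [//|Pxy] := compressed_div H Ts Pp Tt Pq div.
  (* If [P_x] lies below [P_y], the factor [1 - P_y] makes [e] vanish. *)
  case: e0; rewrite eE; rewrite -xE -yE in Pxy.
  by rewrite -[in X in _ - X]Pxy -smulA S_ub // Pxy subrr.
have c_B b : b \in (B : seq X) -> half_standard P T b /\ compressed P T s p b.
  move=> bB; have [Tb db] : homogeneous T d (unit_deg i) b by exact: BT.
  have bE : b = lact1 (Some b) (star b ** b).
    by rewrite /= smulA (sga_T_piso H Tb).
  have PQ := Q_in_P H Tb.
  split; first by rewrite bE /=; exact: half_standard_TP.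
  rewrite xE in p0N0; rewrite bE; apply: (compressed_nondiv H) => //.
  (* Division is impossible: in direction [i] the degree of [s] is 0, that of [b] is 1. *)
  move=> [ga [Tga bga sE]].
  have Tb1 : carrier (adjoin_unit (gen_magma T)) (Some b) by [].
  have := deg1_mul H Tb1 Tga bga i.
  rewrite -sE /= db /unit_deg asboolT // add1n.
  have -> // : deg1 d s i = 0%N by case: (s) Ts' => // t [].
rewrite xE in p0N0.
have [|g [xgN0 ann]] :=
    compressed_not_covering H free Ts Pp (ys := ys ++ B) p0N0.
  by move=> y; rewrite mem_cat => /orP[/c_ys|/c_B].
rewrite -xE in xgN0 ann.
(* The element [e] fixes [x g], since all the [P_y] kill it; yet [e] is absorbed by the sum of the
   [P_b], which kills [x g]. *)
apply: xgN0; transitivity (e ** (x ** g)).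
  rewrite eE smulBl -(smulA (Pr x) S) proj_sup_annihil => [|_ /mapP[y yys ->]].
    by rewrite smul0r subr0 smulA -(smulA x) (half_standard_piso H Hx).
  by apply: ann; rewrite mem_cat yys.
rewrite -eB -smulA smul_suml big_seq big1 ?smul0r // => b bB.
by apply: ann; rewrite mem_cat bB orbT.
Qed.
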